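(* Let $\mathcal H$ be a reproducing kernel Hilbert space of functions $f(z)=\sum_{\alpha\in\ell}f_\alpha z^\alpha$ depending on a countable number of variables $z=(z_1,z_2,\ldots)$, defined in a neighborhood of the origin by convergent power series, and assume that the Leibenzon operators $\mathcal R_j$, $j=1,2,\ldots$, are uniformly bounded in $\mathcal H$ (that is, each $\mathcal R_j$ is a bounded operator from $\mathcal H$ into itself and $\sup_j\|\mathcal R_j\|<\infty$). Let $(A_j)_{j\ge1}$ be any uniformly bounded family of commuting operators on $\mathcal H$ which solves Gleason's problem in $\mathcal H$, i.e. $A_jA_k=A_kA_j$ for all $j,k$, $\sup_j\|A_j\|<\infty$, and $$f(z)-f(0)=\sum_{j=1}^\infty z_j(A_jf)(z)$$ for every $f\in\mathcal H$ and every $z$ in the neighborhood of the origin on which the functions are defined. Then $A_j=\mathcal R_j$ for all $j$.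
   Context: $\ell$ is the set of sequences $\alpha=(\alpha_1,\alpha_2,\ldots)$ of nonnegative integers with only finitely many nonzero entries, $|\alpha|=\sum_j\alpha_j$, $z^\alpha=\prod_j z_j^{\alpha_j}$, and $e_j\in\ell$ has $j$-th entry $1$ and all others $0$. A neighborhood of the origin is a subset of $\mathbb C^{\mathbb N}$ containing, for some $r\in\mathbb N$ and $\delta>0$, the set $K_r(\delta)=\{z\in\mathbb C^{\mathbb N}: \sum_{\alpha\ne0}|z|^\alpha(2\mathbb N)^{r\alpha}<\delta^2\}$, where $|z|^\alpha=\prod_j|z_j|^{\alpha_j}$ and $(2\mathbb N)^{r\alpha}=\prod_j(2j)^{r\alpha_j}$; the power series of the functions in $\mathcal H$ converge absolutely on such a set. The Leibenzon operators are defined on power series by $$\mathcal R_jf(z)=\sum_{\alpha\in\ell,\ \alpha_j\ge1}\frac{\alpha_j}{|\alpha|}f_\alpha z^{\alpha-e_j},\qquad f(z)=\sum_{\alpha\in\ell}f_\alpha z^\alpha .$$ *)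

(* Defs.v *)
From HB Require Import structures.
From mathcomp Require Import all_boot all_order all_algebra finmap.
From mathcomp Require Import all_classical all_reals all_analysis.
From mathcomp Require Import complex.
From mathcomp.analysis.showcase Require summability.
Import Order.TTheory GRing.Theory Num.Theory.
Import numFieldNormedType.Exports.

Set Implicit Arguments.
Unset Strict Implicit.
Unset Printing Implicit Defensive.

Local Open Scope classical_set_scope.
Local Open Scope ring_scope.
Local Open Scope complex_scope.

(* Variables are numbered from 0: index [j] stands for the variable z_(j+1). *)
Definition cseq (R : realType) := nat -> R[i].

Definition multi_index := {fsfun nat -> nat with 0%N}.

Definition mi0 : multi_index := [fsfun].

(* alpha - e_j, meant for alpha_j >= 1 *)
Definition mi_pred (j : nat) (a : multi_index) : multi_index :=
  [fsfun a with j |-> (a j).-1].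

Definition mi_size (a : multi_index) : nat := \sum_(j <- finsupp a) a j.

Definition mi_exp (K : comNzRingType) (z : nat -> K) (a : multi_index) : K :=
  \prod_(j <- finsupp a) z j ^+ a j.

(* (2N)^(r alpha) = prod_(j >= 1) (2 j)^(r alpha_j) *)
Definition weight (r : nat) (a : multi_index) : nat :=
  \prod_(j <- finsupp a) (2 * j.+1) ^ (r * a j).

Definition Kset (R : realType) (r : nat) (delta : R) : set (cseq R) :=
  [set z | (\esum_(a in [set a | a <> mi0])
              (mi_exp (fun j => Normc.normc (z j)) a * (weight r a)%:R)%:E
            < (delta ^+ 2)%:E)%E].

Definition nbhd_origin (R : realType) (Omega : set (cseq R)) : Prop :=
  exists r : nat, exists2 delta : R, 0 < delta & Kset r delta `<=` Omega.

Lemma nbhd_origin0 (R : realType) (Omega : set (cseq R)) :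
  nbhd_origin Omega -> (fun=> 0) \in Omega.
Proof.
move=> [r [delta d0 sub]]; apply/mem_set/sub; rewrite /Kset /=.
rewrite esum1 ?lte_fin ?exprn_gt0// => a /= a0.
suff -> : mi_exp (fun=> Normc.normc (0 : R[i])) a = 0 by rewrite mul0r.
have [j ja] : exists j, j \in finsupp a.
  apply: contrapT => /forallNP na; apply: a0; apply/fsfunP => j.
  by rewrite [RHS]fsfun0E fsfun_dflt//; apply/negP/na.
have n0 : Normc.normc (0 : R[i]) = 0 by exact: Normc.normc0.
rewrite /mi_exp (big_fsetD1 j)// n0 expr0n.
by move: ja; rewrite mem_finsupp => /negbTE ->; rewrite /= mul0r.
Qed.

Definition origin (R : realType) (Omega : set (cseq R))
  (O : nbhd_origin Omega) : Omega := exist _ (fun=> 0) (nbhd_origin0 O).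

(* Convergence along finite subsets of [I], i.e. unconditional summation. *)
Definition has_sum (K : numFieldType) (I : choiceType) (t : I -> K) (s : K) :=
  summability.partial_sum t @ summability.totally --> s.

Definition series_cvg_to (K : numFieldType) (u : nat -> K) (s : K) :=
  series u @ \oo --> s.

Definition abs_has_sum (R : realType) (I : choiceType) (t : I -> R[i])
    (s : R[i]) :=
  summable [set: I] (fun i => (Normc.normc (t i))%:E) /\ has_sum t s.

Definition power_series_expansion (R : realType) (Omega : set (cseq R))
    (c : multi_index -> R[i]) (f : Omega -> R[i]) : Prop :=
  forall z : Omega, abs_has_sum (fun a => c a * mi_exp (val z) a) (f z).

Definition leibenzon_term (R : realType) (j : nat) (c : multi_index -> R[i])
    (z : cseq R) (a : multi_index) : R[i] :=
  if (0 < a j)%N then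
    (a j)%:R / (mi_size a)%:R * c a * mi_exp z (mi_pred j a)
  else 0.

(* [g] is the function R_j f on [Omega] *)
Definition leibenzon_image (R : realType) (Omega : set (cseq R)) (j : nat)
    (f g : Omega -> R[i]) : Prop :=
  exists2 c, power_series_expansion c f &
    forall z : Omega, abs_has_sum (leibenzon_term j c (val z)) (g z).

Section Hilbert.
Variables (R : realType) (H : lmodType R[i]) (dot : {dot H for Num.conj}).

Definition hnorm (u : H) : R := Num.sqrt (complex.Re (dot u u)).

Definition hcomplete : Prop :=
  forall u : nat -> H,
    (forall e : R, 0 < e -> exists N : nat, forall m n : nat,
       (N <= m)%N -> (N <= n)%N -> hnorm (u m - u n) < e) ->
    exists l : H, hnorm (u n - l) @[n --> \oo] --> (0 : R).

Definition opnorm (T : H -> H) : \bar R :=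
  ereal_sup [set (hnorm (T f))%:E | f in [set f | hnorm f <= 1]].

(* For linear [T j], finiteness of the supremum includes boundedness of each
   [T j], since [opnorm] takes the value +oo on unbounded operators. *)
Definition uniformly_bounded (T : nat -> H -> H) : Prop :=
  (ereal_sup (range (fun j => opnorm (T j))) < +oo)%E.

End Hilbert.

(* [H] is a linear space of functions on [X], with [val] the inclusion. *)
Definition reproducing_kernel_hilbert (R : realType) (X : Type)
    (P : pred (X -> R[i]^o)) (H : subLmodType P)
    (dot : {dot H for Num.conj}) : Prop :=
  hcomplete dot /\
  exists k : X -> X -> R[i], forall w : X,
    exists2 kw : H, val kw = k ^~ w & forall f : H, val f w = dot f kw.

Definition solves_gleason (R : realType) (Omega : set (cseq R))
    (O : nbhd_origin Omega) (P : pred (Omega -> R[i]^o)) (H : subLmodType P)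
    (A : nat -> H -> H) : Prop :=
  forall (f : H) (z : Omega),
    series_cvg_to (fun j => val z j * val (A j f) z : R[i])
      (val f z - val f (origin O)).

(* Main.v *)
Require Import Defs.
From HB Require Import structures.
From mathcomp Require Import all_boot all_order all_algebra finmap.
From mathcomp Require Import all_classical all_reals all_analysis.
From mathcomp Require Import complex.
From mathcomp.analysis.showcase Require summability.
From mathcomp Require Import ring lra.
Import Order.TTheory GRing.Theory Num.Theory.
Import numFieldNormedType.Exports.

Set Implicit Arguments.
Unset Strict Implicit.
Unset Printing Implicit Defensive.

Local Open Scope classical_set_scope.
Local Open Scope ring_scope.
Local Open Scope complex_scope.

(* On points with finitely many nonzero coordinates Gleason's equation is a
   finite identity of power series; comparing coefficients gives, for a <> 0,
     f_a = sum_(j, a_j >= 1) (A_j f)_(a - e_j).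
   By induction on |b|, using A_j A_k = A_k A_j, this recursion forces
     (|b| + 1) (A_j f)_b = (b_j + 1) f_(b + e_j),
   so A_j f and R_j f have the same power series.  Coefficients are unique
   because the neighborhood contains the curves z_j = tau q^(w_j), 0 < q <= 1,
   j < N, and the weights w_j can be chosen so that a given lowest coefficient
   dominates the series as q -> 0+. *)

Import Normc.
#[local] Existing Instance summability.totally_filter.

(** * Multi-indices and their shifts by one variable *)

(** Lets several multi-indices be compared over one common range of variables instead of over their
    different supports. *)
Lemma big_finsupp (T : Type) (idx : T) (op : Monoid.com_law idx)
    (a : multi_index) (s : seq nat) (F : nat -> T) :
  uniq s -> {subset finsupp a <= s} -> (forall j, a j = 0%N -> F j = idx) ->
  \big[op/idx]_(j <- finsupp a) F j = \big[op/idx]_(j <- s) F j.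
Proof.
move=> us sub F0; rewrite [RHS](bigID (mem (finsupp a)))/=.
rewrite [X in op _ X]big1; last first.
  by move=> j; rewrite mem_finsupp negbK => /eqP/F0.
rewrite Monoid.mulm1 -[RHS]big_filter; apply: perm_big; apply: uniq_perm.
- exact: fset_uniq.
- exact: filter_uniq.
- move=> j; rewrite mem_filter; have := sub j.
  by case: (j \in finsupp a) => // ->.
Qed.

Definition mi_succ (j : nat) (a : multi_index) : multi_index :=
  [fsfun a with j |-> (a j).+1].

Definition in_vars (N : nat) (a : multi_index) : Prop :=
  forall j, (N <= j)%N -> a j = 0%N.

Lemma mi_succE j a k : mi_succ j a k = if k == j then (a j).+1 else a k.
Proof. by rewrite fsfun_withE. Qed.

Lemma mi_predE j a k : mi_pred j a k = if k == j then (a j).-1 else a k.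
Proof. by rewrite fsfun_withE. Qed.

Lemma mi_succK j : cancel (mi_succ j) (mi_pred j).
Proof.
move=> a; apply/fsfunP => k; rewrite mi_predE !mi_succE eqxx.
by case: eqP => [->|].
Qed.

Lemma mi_predK j (a : multi_index) : (0 < a j)%N -> mi_succ j (mi_pred j a) = a.
Proof.
move=> aj; apply/fsfunP => k; rewrite mi_succE !mi_predE eqxx.
by case: eqP => [->|]//; rewrite prednK.
Qed.

Lemma mi_pred_succ j k a : k != j ->
  mi_pred k (mi_succ j a) = mi_succ j (mi_pred k a).
Proof.
move=> kj; apply/fsfunP => i; rewrite mi_predE !mi_succE !mi_predE.
rewrite (negbTE kj) [j == k]eq_sym (negbTE kj).
by case: (i =P k) => [->|//]; rewrite (negbTE kj).
Qed.

Lemma finsupp_in_vars N a : in_vars N a -> {subset finsupp a <= index_iota 0 N}.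
Proof.
move=> Na j; rewrite mem_finsupp mem_index_iota /=; apply: contraNT.
by rewrite -leqNgt => /Na ->.
Qed.

Lemma ex_in_vars (a : multi_index) : exists N, in_vars N a.
Proof.
exists (\max_(j <- finsupp a) j).+1 => j hj; apply: fsfun_dflt.
by apply: contraL hj => ja; rewrite -ltnNge ltnS (leq_bigmax_seq (F := id)).
Qed.

Lemma in_varsW M N a : (M <= N)%N -> in_vars M a -> in_vars N a.
Proof. by move=> MN Ma j Nj; apply: Ma; exact: leq_trans Nj. Qed.

Lemma mi_size_ord N a : in_vars N a -> mi_size a = (\sum_(j < N) a j)%N.
Proof.
move=> Na; rewrite /mi_size (big_finsupp _ _ (finsupp_in_vars Na)) ?iota_uniq//.
by rewrite big_mkord.
Qed.

Lemma mi_exp_ord (K : comNzRingType) N a (z : nat -> K) : in_vars N a ->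
  mi_exp z a = \prod_(j < N) z j ^+ a j.
Proof.
move=> Na; rewrite /mi_exp (big_finsupp _ _ (finsupp_in_vars Na)) ?iota_uniq//.
  by rewrite big_mkord.
by move=> j ->.
Qed.

Lemma weight_ord N r a : in_vars N a ->
  weight r a = (\prod_(j < N) (2 * j.+1) ^ (r * a j))%N.
Proof.
move=> Na; rewrite /weight (big_finsupp _ _ (finsupp_in_vars Na)) ?iota_uniq//.
  by rewrite big_mkord.
by move=> j ->; rewrite muln0.
Qed.

Lemma mi_exp_out (K : comNzRingType) N a (z : nat -> K) :
  (forall j, (N <= j)%N -> z j = 0) -> ~ in_vars N a -> mi_exp z a = 0.
Proof.
move=> z0 /existsNP[j] /not_implyP[Nj /eqP aj].
have ja : j \in finsupp a by rewrite mem_finsupp.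
by rewrite /mi_exp (big_fsetD1 j)//= z0// expr0n (negbTE aj) mul0r.
Qed.

Lemma in_vars_succ N j (a : multi_index) :
  (j < N)%N -> in_vars N a -> in_vars N (mi_succ j a).
Proof.
move=> jN Na k Nk; rewrite mi_succE (Na k Nk); case: eqP => // kj.
by move: jN; rewrite -kj ltnNge Nk.
Qed.

Lemma mi_size_succ j a : mi_size (mi_succ j a) = (mi_size a).+1.
Proof.
have [N Na] := ex_in_vars a.
(* The bound on the variables is raised so that it also covers [j]. *)
have /in_varsW Na' := Na; have {Na'}Na := Na' _ (leq_maxl N j.+1).
set M := maxn _ _ in Na; have jM : (j < M)%N by rewrite leq_max ltnSn orbT.
rewrite (mi_size_ord Na) (mi_size_ord (in_vars_succ jM Na)).
rewrite (bigD1 (Ordinal jM))//= [in RHS](bigD1 (Ordinal jM))//=.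
rewrite mi_succE eqxx addSn; congr (_ + _).+1.
by apply: eq_bigr => k kj; rewrite mi_succE ifN.
Qed.

Lemma mi_exp_succ (K : comNzRingType) j a (z : nat -> K) :
  mi_exp z (mi_succ j a) = z j * mi_exp z a.
Proof.
have [N Na] := ex_in_vars a.
have /in_varsW Na' := Na; have {Na'}Na := Na' _ (leq_maxl N j.+1).
set M := maxn _ _ in Na; have jM : (j < M)%N by rewrite leq_max ltnSn orbT.
rewrite (mi_exp_ord _ Na) (mi_exp_ord _ (in_vars_succ jM Na)).
rewrite (bigD1 (Ordinal jM))//= [in RHS](bigD1 (Ordinal jM))//=.
rewrite mi_succE eqxx exprS -!mulrA; congr (_ * (_ * _)).
by apply: eq_bigr => k kj; rewrite mi_succE ifN.
Qed.

Lemma mi_size_eq0 a : mi_size a = 0%N -> a = mi0.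
Proof.
have [N Na] := ex_in_vars a; rewrite (mi_size_ord Na) => /eqP.
rewrite sum_nat_eq0 => /forallP a0; apply/fsfunP => j.
rewrite [RHS]fsfun0E; have [/Na//|jN] := leqP N j.
exact/eqP/(a0 (Ordinal jN)).
Qed.

(** Uniqueness of base-[m] digits: reduction modulo [m] gives the lowest digit, which is cancelled
    before dividing by [m]. *)
Lemma digits_inj m N (a b : nat -> nat) :
    (forall j, (j < N)%N -> (a j < m)%N) ->
    (forall j, (j < N)%N -> (b j < m)%N) ->
    (\sum_(j < N) m ^ j * a j = \sum_(j < N) m ^ j * b j)%N ->
  forall j, (j < N)%N -> a j = b j.
Proof.
elim: N a b => [//|N IH] a b am bm; rewrite !big_ord_recl/= !mul1n.
have E (c : nat -> nat) : (\sum_(i < N) m ^ bump 0 i * c (bump 0 i) =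
    (\sum_(i < N) m ^ i * c i.+1) * m)%N.
  rewrite big_distrl/=; apply: eq_bigr => i _.
  by rewrite /bump/= add1n expnS -!mulnA mulnC -mulnA.
rewrite !E => eab.
have m0 : (0 < m)%N by rewrite (leq_ltn_trans _ (am 0%N _)).
have e0 : a 0%N = b 0%N.
  have := congr1 (modn^~ m) eab.
  by rewrite ![(_ + _ * m)%N]addnC !modnMDl !modn_small ?am ?bm.
move: eab; rewrite e0 => /addnI/eqP; rewrite eqn_pmul2r// => /eqP eab.
case=> [//|j] /= jN; apply: (IH (a \o succn) (b \o succn)) => //= i iN.
  exact: am.
exact: bm.
Qed.

(** * Moduli, geometric sums, and small polydiscs inside [Kset] *)

Lemma normc_ge0 (R : rcfType) (x : R[i]) : 0 <= normc x.
Proof. by case: x => u v; rewrite sqrtr_ge0. Qed.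

Lemma normc_real (R : rcfType) (x : R) : 0 <= x -> normc x%:C = x.
Proof. by move=> x0; rewrite /normc/= expr0n/= addr0 sqrtr_sqr ger0_norm. Qed.

Lemma normcX (R : rcfType) (x : R[i]) n : normc (x ^+ n) = normc x ^+ n.
Proof. by elim: n => [|n IH]; rewrite ?expr0 ?normc1// !exprS normcM IH. Qed.

Lemma normc_sum (R : rcfType) (I : Type) (J : seq I) (t : I -> R[i]) :
  normc (\sum_(i <- J) t i) <= \sum_(i <- J) normc (t i).
Proof.
elim: J => [|a J IH]; first by rewrite !big_nil normc0.
by rewrite !big_cons; apply: le_trans (le_normcD _ _) _; rewrite lerD2l.
Qed.

Lemma sum_half_pow_le (R : realFieldType) n : \sum_(k < n) (2^-1 : R) ^+ k <= 2.
Proof.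
suff -> : \sum_(k < n) (2^-1 : R) ^+ k = 2 - 2 * 2^-1 ^+ n.
  by rewrite gerBl mulr_ge0// exprn_ge0.
elim: n => [|n IH]; first by rewrite big_ord0 expr0; lra.
by rewrite big_ord_recr/= IH exprS; lra.
Qed.

(** With [B] bounding all entries, [J] embeds into the functions from ['I_N] to ['I_B.+1]; the sum
    over all of these factors into [N] geometric sums, each at most 2. *)
Lemma sum_half_mi_le (R : realFieldType) N (J : seq multi_index) :
  uniq J -> (forall a, a \in J -> in_vars N a) ->
  \sum_(a <- J) \prod_(j < N) (2^-1 : R) ^+ a j <= 2 ^+ N.
Proof.
move=> uJ JN; pose B := (\max_(a <- J) \max_(j < N) a j)%N.
have aB a (j : 'I_N) : a \in J -> (a j <= B)%N.
  move=> aJ; apply: leq_trans (leq_bigmax (F := fun j : 'I_N => a j) j) _.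
  exact: (leq_bigmax_seq (F := fun b : multi_index => \max_(j < N) b j)%N a).
pose phi (a : multi_index) : {ffun 'I_N -> 'I_B.+1} :=
  [ffun j : 'I_N => inord (a j)].
have phiE a j : a \in J -> phi a j = a j :> nat.
  by move=> aJ; rewrite ffunE inordK// ltnS aB.
pose G (f : {ffun 'I_N -> 'I_B.+1}) : R := \prod_j 2^-1 ^+ f j.
have G0 f : 0 <= G f by apply: prodr_ge0 => j _; rewrite exprn_ge0.
have -> : \sum_(a <- J) \prod_(j < N) (2^-1 : R) ^+ a j =
    \sum_(f <- map phi J) G f.
  rewrite big_map big_seq [RHS]big_seq; apply: eq_bigr => a aJ.
  by apply: eq_bigr => j _; rewrite phiE.
have umap : uniq (map phi J).
  rewrite map_inj_in_uniq// => a b aJ bJ ab; apply/fsfunP => j.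
  have [Nj|jN] := leqP N j; first by rewrite (JN a)// (JN b).
  by rewrite -(phiE a (Ordinal jN))// -(phiE b (Ordinal jN))// ab.
rewrite big_uniq//=; apply: (@le_trans _ _ (\sum_f G f)).
  by rewrite [leRHS](bigID (mem (map phi J)))/= lerDl sumr_ge0.
rewrite /G -(bigA_distr_bigA (fun (j : 'I_N) (k : 'I_B.+1) => (2^-1 : R) ^+ k)).
have -> : 2 ^+ N = \prod_(j < N) (2 : R) by rewrite prodr_const card_ord.
apply: ler_prod => j _.
by rewrite sum_half_pow_le andbT sumr_ge0// => k _; rewrite exprn_ge0.
Qed.

(** If every weighted coordinate is at most [y], the term of [a] is at most [y ^+ mi_size a].
    Splitting [y] as [2 * y] times 1/2 leaves a convergent geometric sum with a small factor in
    front. *)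
Lemma Kset_finite_vars (R : realType) (r N : nat) (delta : R) : 0 < delta ->
  exists2 tau : R, 0 < tau & forall z : cseq R,
    (forall j, (j < N)%N -> normc (z j) <= tau) ->
    (forall j, (N <= j)%N -> z j = 0) -> Kset r delta z.
Proof.
(* The first bound gives [2 * y <= 1]; the second makes the final estimate [2 * y * 2 ^+ N] at most
   half of [delta ^+ 2]. *)
move=> d0; pose y : R := Num.min 2^-1 (delta ^+ 2 / (4 * 2 ^+ N)).
have N0 : 0 < 2 ^+ N :> R by rewrite exprn_gt0.
have y0 : 0 < y by rewrite lt_min invr_gt0 ltr0n divr_gt0 ?mulr_gt0 ?exprn_gt0.
have y2 : y <= 2^-1 by rewrite ge_min lexx.
have yd : 2 * y * 2 ^+ N < delta ^+ 2.
  have : y * (4 * 2 ^+ N) <= delta ^+ 2.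
    by rewrite -ler_pdivlMr ?mulr_gt0// ge_min lexx orbT.
  have := mulr_gt0 y0 N0; lra.
(* [W] dominates the weight [(2 * j.+1) ^ r] of every variable [j < N]. *)
pose W : nat := (2 * N.+1) ^ r.
have W0 : 0 < W%:R :> R by rewrite ltr0n expn_gt0 muln_gt0.
exists (y / W%:R); first exact: divr_gt0.
move=> z zle z0; rewrite /Kset/=.
apply: (@le_lt_trans _ _ (2 * y * 2 ^+ N)%:E); last by rewrite lte_fin.
have term_le a : in_vars N a -> a <> mi0 ->
    mi_exp (fun j => normc (z j)) a * (weight r a)%:R
      <= 2 * y * \prod_(j < N) 2^-1 ^+ a j.
  move=> Na a0; rewrite (mi_exp_ord _ Na) (weight_ord _ Na) natr_prod.
  rewrite -big_split/=.
  apply: (@le_trans _ _ (\prod_(j < N) y ^+ a j)).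
    apply: ler_prod => j _; rewrite natrX exprM -exprMn.
    have p0 : 0 <= normc (z j) * (2 * j.+1)%:R ^+ r.
      by rewrite mulr_ge0 ?normc_ge0 ?exprn_ge0.
    rewrite exprn_ge0//= lerXn2r// ?nnegrE ?(ltW y0)//.
    apply: (@le_trans _ _ (y / W%:R * W%:R)); last by rewrite divfK ?gt_eqF.
    apply: ler_pM; rewrite ?normc_ge0 ?exprn_ge0 ?zle//.
    rewrite -natrX ler_nat /W; case: (r) => [//|r'].
    by rewrite leq_exp2r// leq_pmul2l// ltnS ltnW.
  have -> : \prod_(j < N) y ^+ a j =
      (2 * y) ^+ mi_size a * \prod_(j < N) 2^-1 ^+ a j.
    rewrite (mi_size_ord Na) expr_sum -big_split/=; apply: eq_bigr => j _.
    by rewrite -exprMn mulrAC divff ?mul1r// pnatr_eq0.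
  apply: ler_wpM2r; first by apply: prodr_ge0 => j _; rewrite exprn_ge0.
  have y21 : 2 * y <= 1 by lra.
  (* As [a] is nonzero, at least one factor [2 * y] survives; the others are at most 1. *)
  case: (mi_size a) (@mi_size_eq0 a) => [/(_ erefl)//|n _].
  by rewrite exprS ler_piMr ?exprn_ile1 ?mulr_ge0// ltW.
apply: ge_ereal_sup => _ [X [finX XI] <-].
rewrite fsbig_finite//= sumEFin lee_fin.
apply: (@le_trans _ _ (\sum_(a <- fset_set X | `[<in_vars N a>])
    2 * y * \prod_(j < N) 2^-1 ^+ a j)).
  rewrite (bigID (fun a => `[<in_vars N a>]))/=.
  rewrite [X in _ + X]big1 ?addr0; last first.
    move=> a /asboolPn Na.
    by rewrite (mi_exp_out _ Na) ?mul0r// => j /z0 ->; rewrite normc0.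
  rewrite big_seq_cond [leRHS]big_seq_cond.
  apply: ler_sum => a /andP[aX /asboolP Na].
  apply: term_le => //; apply: XI.
  by move: aX; rewrite in_fset_set// inE.
rewrite -mulr_sumr; apply: ler_wpM2l; first by rewrite mulr_ge0 ?(ltW y0).
rewrite -big_filter; apply: sum_half_mi_le; first exact/filter_uniq/fset_uniq.
by move=> a; rewrite mem_filter => /andP[/asboolP].
Qed.

(** * Absolutely convergent sums over an arbitrary index type *)

Lemma partial_sumE (I : choiceType) (V : zmodType) (t : I -> V) (J : {fset I}) :
  summability.partial_sum t J = \sum_(i <- J) t i.
Proof. by rewrite /summability.partial_sum big_seq_fsetE. Qed.

(** Absolute summability as one real bound on all finite sums, which avoids extended reals in the
    algebra of sums below. *)
Definition abs_bounded (R : realType) (I : choiceType) (t : I -> R[i]) : Prop :=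
  exists S : R, forall J : {fset I}, \sum_(i <- J) normc (t i) <= S.

Lemma summable_abs_bounded (R : realType) (I : choiceType) (t : I -> R[i]) :
  summable [set: I] (fun i => (normc (t i))%:E) -> abs_bounded t.
Proof.
rewrite /summable.
set s := (X in (X < _)%E) => soo.
have s0 : (0 <= s)%E by apply: esum_ge0.
exists (fine s) => J; rewrite -lee_fin fineK; last by rewrite ge0_fin_numE.
apply: esum_ge; exists [set` J]; first by split; [exact: finite_fset|].
rewrite fsbig_finite/=; [rewrite set_fsetK|exact: finite_fset].
rewrite -sumEFin le_eqVlt; apply/orP; left; apply/eqP; apply: eq_bigr => i _.
by rewrite /= ger0_norm// normc_ge0.
Qed.

Section AbsolutelySummable.
Variables (R : realType) (I : choiceType).
Implicit Types (t u : I -> R[i]) (s : R[i]).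

Definition abs_sums_to t s : Prop := abs_bounded t /\ has_sum t s.

Lemma abs_has_sumW t s : abs_has_sum t s -> abs_sums_to t s.
Proof. by case=> /summable_abs_bounded. Qed.

Lemma has_sumP t s : has_sum t s <->
  forall e : R, 0 < e -> exists A : {fset I}, forall B : {fset I},
    (A `<=` B)%fset -> normc (s - \sum_(i <- B) t i) < e.
Proof.
split=> [/cvgrPdist_lt ts e e0|ts].
  have [|A _ AP] := ts e%:C; first by rewrite ltcR.
  by exists A => B /AP/=; rewrite partial_sumE normc_def ltcR; case: (_ - _).
apply/cvgrPdist_lt => e e0.
(* Convergence in [R[i]] quantifies over positive complex numbers, and these are real. *)
have [eR e1] : e = (complex.Re e)%:C /\ 0 < complex.Re e.
  by case: e e0 => a b; rewrite ltcE/= => /andP[/eqP -> ->].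
have [A AP] := ts _ e1; exists A => // B /AP /=.
by rewrite partial_sumE eR normc_def ltcR; case: (_ - _).
Qed.

Lemma has_sum_unique t s s' : has_sum t s -> has_sum t s' -> s = s'.
Proof.
by move=> ts ts'; exact: (cvg_unique (@norm_hausdorff _ _) ts ts').
Qed.

Lemma abs_sums_to_eq t u s : t =1 u -> abs_sums_to t s -> abs_sums_to u s.
Proof. by move=> /funext ->. Qed.

Lemma abs_sums_toD t u s s' : abs_sums_to t s -> abs_sums_to u s' ->
  abs_sums_to (fun i => t i + u i) (s + s').
Proof.
move=> [[S tS] ts] [[S' uS'] us']; split.
  exists (S + S') => J; apply: le_trans (lerD (tS J) (uS' J)).
  by rewrite -big_split/=; apply: ler_sum => i _; exact: le_normcD.
apply/has_sumP => e e0; have e2 : 0 < e / 2 by rewrite divr_gt0.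
have /has_sumP/(_ _ e2)[A AP] := ts; have /has_sumP/(_ _ e2)[A' AP'] := us'.
exists (A `|` A')%fset => B; rewrite fsubUset => /andP[/AP lt1 /AP' lt2].
rewrite big_split/= opprD addrACA.
by apply: le_lt_trans (le_normcD _ _) _; rewrite [e]splitr ltrD.
Qed.

Lemma abs_sums_toZ k t s : abs_sums_to t s ->
  abs_sums_to (fun i => k * t i) (k * s).
Proof.
move=> [[S tS] ts]; split.
  exists (normc k * S) => J; under eq_bigr do rewrite normcM.
  by rewrite -mulr_sumr ler_wpM2l ?normc_ge0.
apply/has_sumP => e e0.
(* Adding 1 keeps the divisor positive when [k] is 0. *)
have k1 : 0 < normc k + 1 by rewrite ltr_wpDl ?normc_ge0.
have /has_sumP/(_ (e / (normc k + 1)))[|A AP] := ts; first exact: divr_gt0.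
exists A => B /AP lt1; rewrite -mulr_sumr -mulrBr normcM.
move: lt1; rewrite ltr_pdivlMr//; apply: le_lt_trans.
by rewrite mulrC ler_wpM2l ?normc_ge0// lerDl.
Qed.

Lemma abs_sums_toB t u s s' : abs_sums_to t s -> abs_sums_to u s' ->
  abs_sums_to (fun i => t i - u i) (s - s').
Proof.
move=> ts /(abs_sums_toZ (-1)) us; have := abs_sums_toD ts us.
rewrite mulN1r; apply: abs_sums_to_eq => i; by rewrite mulN1r.
Qed.

Lemma abs_sums_to_single i0 k :
  abs_sums_to (fun i => if i == i0 then k else 0) k.
Proof.
(* Stated for a general [V], to serve both for the moduli and for the complex terms. *)
have E (V : zmodType) (x : V) (J : {fset I}) : i0 \in J ->
    \sum_(i <- J) (if i == i0 then x else 0) = x.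
  move=> i0J; rewrite (big_fsetD1 i0)//= eqxx big1_seq ?addr0// => i.
  by rewrite !inE => /andP[_ /andP[/negbTE ->]].
split.
  exists (normc k) => J; have [i0J|i0J] := boolP (i0 \in J).
    rewrite -[leRHS](E _ _ J)//; apply: ler_sum => i _.
    by case: ifP; rewrite ?normc0.
  rewrite big1_seq ?normc_ge0// => i /andP[_ iJ].
  by case: eqP => [ii0|_]; [rewrite -ii0 iJ in i0J|rewrite normc0].
apply/has_sumP => e e0; exists [fset i0]%fset => B; rewrite fsub1set => i0B.
by rewrite E// subrr normc0.
Qed.

End AbsolutelySummable.

(** The condition [h (g x) != x] describes the points outside the image of [h]. Used with [h] the
    shift [mi_succ j], whose image is the set of multi-indices with positive [j]-th entry. *)
Lemma abs_sums_to_reindex (R : realType) (I I' : choiceType) (h : I -> I')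
    (g : I' -> I) (t : I' -> R[i]) (s : R[i]) :
  cancel h g -> (forall x, h (g x) != x -> t x = 0) ->
  abs_sums_to (t \o h) s -> abs_sums_to t s.
Proof.
move=> hK t0.
(* The preimage of [B] under [h]: finite sums of [t] over [B] become finite sums of [t \o h] over
   [pre B]. *)
pose pre (B : {fset I'}) := [fset g x | x in [fset x in B | h (g x) == x]]%fset.
have sum_pre (V : nmodType) (F : I' -> V) B :
    (forall x, h (g x) != x -> F x = 0) ->
    \sum_(i <- pre B) F (h i) = \sum_(x <- B) F x.
  move=> F0; rewrite big_imfset/=; last first.
    move=> x y; rewrite !inE/= => /andP[_ /eqP xE] /andP[_ /eqP yE] xy.
    by rewrite -xE xy.
  rewrite big_fset/= [RHS](bigID (fun x => h (g x) == x))/=.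
  rewrite [X in _ = _ + X]big1 ?addr0//.
  by apply: eq_bigr => x /eqP ->.
move=> [[S tS] /has_sumP ts]; split.
  exists S => B; rewrite -(sum_pre _ (fun x => normc (t x))).
    exact: tS.
  by move=> x /t0 ->; exact: normc0.
apply/has_sumP => e /ts[A AP]; exists [fset h i | i in A]%fset => B AB.
rewrite -(sum_pre _ t)//; apply: AP; apply/fsubsetP => i iA.
apply/imfsetP; exists (h i); rewrite ?hK//= !inE hK eqxx andbT.
by apply: (fsubsetP AB); exact: in_imfset.
Qed.

(** * Uniqueness of power series coefficients *)

(* As [q -> 0+] the term of lowest exponent dominates the series. *)
Lemma lowest_term_eq0 (R : realType) (I : choiceType) (w : I -> nat)
    (d : I -> R[i]) (a : I) :
  abs_bounded d ->
  (forall q : R, 0 < q <= 1 -> has_sum (fun i => d i * q%:C ^+ w i) 0) ->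
  (forall i, i != a -> d i != 0 -> (w a < w i)%N) -> d a = 0.
Proof.
move=> [S dS] ds wa.
(* The other nonzero terms carry at least one more factor [q] than the term of [a], and the whole
   sum is 0; divide by [q ^+ w a]. *)
have bnd (q : R) : 0 < q <= 1 -> normc (d a) <= q * S.
  move=> /[dup] q01 /andP[q0 q1].
  have qn n : normc (q%:C ^+ n) = q ^+ n by rewrite normcX normc_real ?ltW.
  rewrite -(@ler_pM2r _ (q ^+ w a)) ?exprn_gt0//.
  apply/ler_addgt0Pr => e e0.
  have /has_sumP/(_ _ e0)[A AP] := ds q q01.
  have /AP := fsubsetUr [fset a]%fset A.
  set B := (_ `|` _)%fset; have aB : a \in B by rewrite !inE eqxx.
  rewrite sub0r normcN (big_fsetD1 a)//=; set rest := \sum_(i <- _) _ => lt_e.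
  have rest_le : normc rest <= q * S * q ^+ w a.
    apply: le_trans (normc_sum _ _) _.
    apply: (@le_trans _ _ (q ^+ (w a).+1 *
        \sum_(i <- (B `\ a)%fset) normc (d i))).
      rewrite mulr_sumr big_seq [leRHS]big_seq; apply: ler_sum => i.
      rewrite !inE => /andP[ia _]; rewrite normcM qn mulrC.
      have [->|di] := eqVneq (d i) 0; first by rewrite normc0 !mulr0.
      by rewrite ler_wpM2r ?normc_ge0// ler_wiXn2l ?wa// ltW.
    rewrite exprS mulrAC ler_wpM2r ?exprn_ge0 ?(ltW q0)//.
    by rewrite ler_wpM2l// ltW.
  rewrite -qn -normcM; set da := d a * _ in lt_e *.
  have -> : da = (da + rest) + - rest by rewrite addrK.
  rewrite qn; apply: le_trans (le_normcD _ _) _; rewrite normcN addrC.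
  by apply: lerD => //; exact: ltW.
apply: eq0_normc; apply/eqP; rewrite eq_le normc_ge0 andbT leNgt.
apply/negP => D0.
have DS : normc (d a) <= S by rewrite -[S]mul1r bnd// ltr01 lexx.
have S0 : 0 < S by exact: lt_le_trans DS.
(* This [q] is at most 1 by [DS], and the bound says that [normc (d a)] is at most half of
   itself. *)
have := bnd (normc (d a) / (2 * S)).
have -> : normc (d a) / (2 * S) * S = normc (d a) / 2 by field; rewrite gt_eqF.
rewrite divr_gt0 ?mulr_gt0//= ler_pdivrMr ?mulr_gt0//.
by move=> /(_ _); lra.
Qed.

(* On multi-indices of size [n] the weight [M |b| + sum_j (n+1)^j b_j] is
   injective (base [n+1] digits), and [M] is so large that all multi-indices of
   size greater than [n] weigh more than the given [a] of size [n]. *)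
Lemma power_series_eq0 (R : realType) (Omega : set (cseq R)) (N : nat)
    (d : multi_index -> R[i]) :
  nbhd_origin Omega ->
  (forall z : Omega, (forall j, (N <= j)%N -> val z j = 0) ->
    abs_sums_to (fun a => d a * mi_exp (val z) a) 0) ->
  forall a, in_vars N a -> d a = 0.
Proof.
move=> [r [delta d0 KO]] dz.
have [tau tau0 tauK] := Kset_finite_vars r N d0.
(* Induction on the size [n], then, within a given size, on the base-[n.+1] value [k]. *)
suff main n k a : in_vars N a -> mi_size a = n ->
    (\sum_(j < N) n.+1 ^ j * a j = k)%N -> d a = 0.
  by move=> a Na; exact: (main _ _ a Na erefl erefl).
elim/ltn_ind: n k a => n IHn; elim/ltn_ind => k IHk a Na an ak.
(* Since [M > k], a size of at least [n.+1] contributes [M * n.+1 > M * n + k], the weight of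
   [a]. *)
pose M := (k.+1)%N.
pose w (b : multi_index) := (\sum_(j < N) (M + n.+1 ^ j) * b j)%N.
have wE b : in_vars N b ->
    (w b = M * mi_size b + \sum_(j < N) n.+1 ^ j * b j)%N.
  move=> Nb; rewrite (mi_size_ord Nb) big_distrr/= -big_split/=.
  by apply: eq_bigr => j _; rewrite mulnDl.
(* Only monomials in the first [N] variables survive on the curve; the powers of [tau] go into the
   coefficients. *)
pose d' (b : multi_index) :=
  if `[<in_vars N b>] then d b * tau%:C ^+ mi_size b else 0.
have termE (q : R) : 0 < q <= 1 ->
    abs_sums_to (fun b => d' b * q%:C ^+ w b) 0.
  move=> /andP[q0 q1].
  (* On this curve the monomial of [b] equals [tau ^+ mi_size b * q ^+ w b]. *)
  pose z : cseq R := fun j =>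
    if (j < N)%N then (tau * q ^+ (M + n.+1 ^ j))%:C else 0.
  have z0 j : (N <= j)%N -> z j = 0 by rewrite /z ltnNge => ->.
  have zO : z \in Omega.
    apply/mem_set/KO/tauK => // j jN; rewrite /z jN normc_real.
      by rewrite ger_pMr// exprn_ile1// ltW.
    by rewrite mulr_ge0 ?exprn_ge0// ltW.
  apply: abs_sums_to_eq (dz (exist _ z zO) z0) => b /=.
  rewrite /d'; case: asboolP => [Nb|Nb]; last first.
    by rewrite (mi_exp_out z0 Nb) mulr0 mul0r.
  rewrite -mulrA (mi_exp_ord _ Nb) (mi_size_ord Nb) /w !expr_sum -big_split/=.
  congr (_ * _); apply: eq_bigr => j _; rewrite /z ltn_ord.
  by rewrite rmorphM rmorphXn/= exprMn exprM.
suff : d' a = 0.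
  rewrite /d'; case: asboolP => // _ /eqP; rewrite mulf_eq0 expf_eq0.
  rewrite fmorph_eq0.
  by rewrite (gt_eqF tau0) andbF orbF => /eqP.
apply: (@lowest_term_eq0 _ _ w).
(* At [q = 1] the series is that of [d'] itself, which gives its absolute bound. *)
- have q1 : 0 < (1 : R) <= 1 by rewrite ltr01 lexx.
  suff [] : abs_sums_to d' 0 by [].
  by apply: abs_sums_to_eq (termE 1 q1) => b; rewrite expr1n mulr1.
- by move=> q /termE[].
move=> b ba; rewrite /d'; case: asboolP => [Nb|_]; last by rewrite eqxx.
rewrite mulf_eq0 negb_or => /andP[db _]; rewrite !wE// an ak.
(* Smaller sizes have zero coefficients by [IHn] and larger sizes outweigh [a]. At equal size, a
   smaller base-[n.+1] value is excluded by [IHk], and an equal one forces [b = a]. *)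
have [bn|nb|bn] := ltngtP (mi_size b) n.
- by rewrite (IHn _ bn _ b Nb erefl erefl) eqxx in db.
- apply: (@leq_trans (M * n.+1)%N); first by rewrite mulnS addnC ltn_add2r.
  apply: (@leq_trans (M * mi_size b)%N); first by rewrite leq_pmul2l.
  exact: leq_addr.
rewrite bn ltn_add2l ltnNge leq_eqVlt; apply/negP => /orP[/eqP bk|bk].
  case/eqP: ba; apply/fsfunP => j.
  have [Nj|jN] := leqP N j; first by rewrite Na// Nb.
  have small c i : in_vars N c -> mi_size c = n -> (c i < n.+1)%N.
    move=> Nc <-; have [/Nc ->//|iN] := leqP N i.
    by rewrite ltnS (mi_size_ord Nc) (bigD1 (Ordinal iN))//= leq_addr.
  apply: (@digits_inj n.+1 N b a) => //; last by rewrite bk ak.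
  - by move=> i _; exact: small.
  - by move=> i _; exact: small.
by rewrite (IHk _ bk b Nb bn erefl) eqxx in db.
Qed.

Lemma power_series_unique (R : realType) (Omega : set (cseq R))
    (c c' : multi_index -> R[i]) (f : Omega -> R[i]) :
  nbhd_origin Omega -> power_series_expansion c f ->
  power_series_expansion c' f -> c = c'.
Proof.
move=> O cf c'f; apply/funext => a; have [N Na] := ex_in_vars a.
apply/eqP; rewrite -subr_eq0; apply/eqP.
apply: (power_series_eq0 O (d := fun a => c a - c' a) _ Na) => z _.
have := abs_sums_toB (abs_has_sumW (cf z)) (abs_has_sumW (c'f z)).
by rewrite subrr; apply: abs_sums_to_eq => b; rewrite mulrBl.
Qed.

(** * Gleason's equation in terms of coefficients *)

Lemma gleason_coefs (R : realType) (Omega : set (cseq R)) (N : nat)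
    (f : Omega -> R[i]) (f0 : R[i]) (g : nat -> Omega -> R[i])
    (c : multi_index -> R[i]) (cg : nat -> multi_index -> R[i]) :
  nbhd_origin Omega -> power_series_expansion c f ->
  (forall j, power_series_expansion (cg j) (g j)) ->
  (forall z : Omega, series_cvg_to (fun j => val z j * g j z) (f z - f0)) ->
  forall a, in_vars N a -> a <> mi0 ->
  c a = \sum_(j < N) if (0 < a j)%N then cg j (mi_pred j a) else 0.
Proof.
move=> O cf cgg fg a Na /eqP a0; apply/eqP; rewrite -subr_eq0; apply/eqP.
pose shift j (a : multi_index) := if (0 < a j)%N then cg j (mi_pred j a) else 0.
(* The coefficients of [f - f0] minus the sum of the [z_j g_j] over [j < N]; multiplication by [z_j]
   is [shift j], and [f0] enters only at [mi0]. *)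
pose d (a : multi_index) :=
  c a - (if a == mi0 then f0 else 0) - \sum_(j < N) shift j a.
suff : d a = 0 by rewrite /d (negbTE a0) subr0.
apply: (power_series_eq0 O (N := N) _ Na) => z z0.
(* The terms with [j >= N] vanish at [z], so the partial sums are eventually constant. *)
have fE : f z - f0 = \sum_(j < N) val z j * g j z.
  apply: (cvg_unique (@norm_hausdorff _ _) (fg z)).
  apply: cvg_near_cst; exists N => // n /= Nn; rewrite /series/=.
  rewrite (big_cat_nat _ Nn)//= big_mkord [X in _ + X]big1_seq ?addr0// => j.
  by rewrite mem_index_iota => /andP[_ /andP[/z0 -> _]]; rewrite mul0r.
have sE j :
    abs_sums_to (fun b => shift j b * mi_exp (val z) b) (val z j * g j z).
  apply: (@abs_sums_to_reindex _ _ _ (mi_succ j) (mi_pred j)) => [|b|].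
  - exact: mi_succK.
  - rewrite /shift; case: ifP => [/mi_predK ->|]; first by rewrite eqxx.
    by rewrite mul0r.
  have := abs_sums_toZ (val z j) (abs_has_sumW (cgg j z)).
  apply: abs_sums_to_eq => b /=.
  by rewrite /shift mi_succE eqxx/= mi_succK mi_exp_succ mulrCA.
have sumE n : abs_sums_to (fun b => (\sum_(j < n) shift j b) * mi_exp (val z) b)
    (\sum_(j < n) val z j * g j z).
  elim: n => [|n IH].
    rewrite big_ord0; apply: abs_sums_to_eq (abs_sums_to_single mi0 0) => b.
    by rewrite big_ord0 mul0r if_same.
  rewrite big_ord_recr/=.
  apply: abs_sums_to_eq (abs_sums_toD IH (sE n)) => b /=.
  by rewrite big_ord_recr/= mulrDl.
have cz := abs_sums_toB (abs_has_sumW (cf z)) (abs_sums_to_single mi0 f0).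
have := abs_sums_toB cz (sumE N).
rewrite -fE subrr; apply: abs_sums_to_eq => b; rewrite /d !mulrBl.
congr (_ - _ - _).
case: eqP => [->|_]; last by rewrite mul0r.
by rewrite /mi_exp finsupp0 big_seq_fset0 mulr1.
Qed.

(** Expand [c (A j f) b] by the recursion. Commutation turns each [A k (A j f)] into [A j (A k f)],
    so induction applies to [A k f] at [mi_pred k b] and yields the terms of the recursion for [f]
    at [mi_succ j b]. *)
Lemma gleason_coef_shift (K : numFieldType) (H : Type) (A : nat -> H -> H)
    (c : H -> multi_index -> K) :
  (forall j k f, A j (A k f) = A k (A j f)) ->
  (forall N f a, in_vars N a -> a <> mi0 ->
    c f a = \sum_(j < N) if (0 < a j)%N then c (A j f) (mi_pred j a) else 0) ->
  forall j f b,
    (mi_size b).+1%:R * c (A j f) b = (b j).+1%:R * c f (mi_succ j b).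
Proof.
move=> AC cA j f b; have [n bn] : exists n, mi_size b = n by exists (mi_size b).
elim/ltn_ind: n b bn j f => n IH b bn j f.
have size_pred k : (0 < b k)%N -> n = (mi_size (mi_pred k b)).+1.
  by move=> bk; rewrite -bn -[in LHS](mi_predK bk) mi_size_succ.
have {}IH k g i : (0 < b k)%N -> n%:R * c (A i g) (mi_pred k b) =
    (mi_pred k b i).+1%:R * c g (mi_succ i (mi_pred k b)).
  by move=> /size_pred nE; rewrite [in LHS]nE (IH (mi_size (mi_pred k b)))// nE.
have [N Nb jN] : exists2 N, in_vars N b & (j < N)%N.
  have [N Nb] := ex_in_vars b; exists (maxn N j.+1).
    by apply: in_varsW Nb; exact: leq_maxl.
  by rewrite leq_max ltnSn orbT.
(* In the recursion for [f] at [mi_succ j b], the term [k = j] is [c (A j f) b]; [T] collects the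
   others. *)
pose T := \sum_(k < N | k != Ordinal jN)
  if (0 < b k)%N then c (A k f) (mi_succ j (mi_pred k b)) else 0.
have -> : c f (mi_succ j b) = c (A j f) b + T.
  rewrite (cA N).
  - rewrite (bigD1 (Ordinal jN))//= mi_succE eqxx/= mi_succK; congr (_ + _).
    apply: eq_bigr => k kj; rewrite mi_succE [X in (0 < X)%N]ifN//.
    by case: ifP => // _; rewrite mi_pred_succ.
  - exact: in_vars_succ.
  - move=> /(congr1 (fun a : multi_index => a j)).
    by rewrite mi_succE eqxx [RHS]fsfun0E.
(* The goal [n.+1 * X = (b j).+1 * (X + T)], with one copy of [X] cancelled on both sides. *)
suff rel : n%:R * c (A j f) b = (b j)%:R * c (A j f) b + (b j).+1%:R * T.
  by rewrite bn -[n.+1%:R]natr1 mulrDl rel mul1r -[(b j).+1%:R]natr1; ring.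
(* The recursion says nothing at [mi0]; there both sides are 0. *)
have [b0|b0] := pselect (b = mi0).
  have bk k : b k = 0%N by rewrite b0 [LHS]fsfun0E.
  rewrite /T big1 => [|k _]; last by rewrite bk.
  have -> : n = 0%N by rewrite -bn /mi_size big1.
  by rewrite bk !mul0r mulr0 addr0.
rewrite {1}(cA N)// mulr_sumr (bigD1 (Ordinal jN))//= /T mulr_sumr.
(* For [k = j] the factor from induction is [(b j).-1.+1 = b j]; for [k != j] the [j]-th entry is
   unchanged and the factor is [(b j).+1]. *)
congr (_ + _).
  case: ifPn => [bj|]; last by rewrite -eqn0Ngt => /eqP ->; rewrite mulr0 mul0r.
  by rewrite IH// mi_predE eqxx prednK// mi_predK.
apply: eq_bigr => k kj; case: ifPn => [bk|]; last by rewrite !mulr0.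
by rewrite AC IH// mi_predE ifN// eq_sym.
Qed.

(** * Identification of the operators *)

Theorem theorem8p1 (R : realType)
    (Omega : set (cseq R)) (O : nbhd_origin Omega)
    (P : pred (Omega -> R[i]^o)) (H : subLmodType P)
    (dot : {dot H for Num.conj})
    (rkhsH : reproducing_kernel_hilbert dot)
    (psH : forall f : H, exists c, power_series_expansion c (val f))
    (L : nat -> {linear H -> H})
    (leibenzonL : forall (j : nat) (f : H),
       leibenzon_image j (val f) (val (L j f)))
    (boundedL : uniformly_bounded dot L)
    (A : nat -> {linear H -> H})
    (boundedA : uniformly_bounded dot A)
    (commA : forall (j k : nat) (f : H), A j (A k f) = A k (A j f))
    (gleasonA : solves_gleason O A) :
  forall (j : nat) (f : H), A j f = L j f.
Proof.
move=> j f; have [c cP] := choice psH.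
have cA N g a : in_vars N a -> a <> mi0 ->
    c g a = \sum_(k < N) if (0 < a k)%N then c (A k g) (mi_pred k a) else 0.
  apply: (gleason_coefs (g := fun k => val (A k g))
    (cg := fun k => c (A k g)) O (cP g)) => [k|].
    exact: cP.
  exact: gleasonA.
have cE := gleason_coef_shift (A := fun k => A k) commA cA j f.
apply: val_inj; apply/funext => z.
have [c' c'f Lz] := leibenzonL j f.
(* The expansion witnessing the Leibenzon image is replaced by the chosen one, by uniqueness. *)
have {Lz} [_ Lz] := Lz z; rewrite (power_series_unique O c'f (cP f)) in Lz.
apply: has_sum_unique Lz.
(* Both values are to be sums of one series: reindexed by [mi_succ j], the Leibenzon series becomes
   the power series of [A j f]. *)
suff [] : abs_sums_to (leibenzon_term j (c f) (val z)) (val (A j f) z) by [].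
apply: (@abs_sums_to_reindex _ _ _ (mi_succ j) (mi_pred j)) => [|a|].
- exact: mi_succK.
- rewrite /leibenzon_term; case: ifP => [/mi_predK ->|//]; by rewrite eqxx.
apply: abs_sums_to_eq (abs_has_sumW (cP (A j f) z)) => a /=.
rewrite /leibenzon_term mi_succE eqxx/= mi_size_succ mi_succK; congr (_ * _).
(* This is [cE] divided by [(mi_size a).+1], which is nonzero in [R[i]]. *)
by rewrite mulrAC -cE mulrAC divff ?mul1r// pnatr_eq0.
Qed.
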